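(* Let $\Gamma_1,\Gamma_2$ be two circles given in the Euclidean plane and let $k$ be a real number. Then the geometric locus of the points $X$ that satisfy the equation $$P_{\Gamma_1}(X)=k\,P_{\Gamma_2}(X)$$ is a circle, possibly degenerate (a line, a single point, or non-existent).
   Context: For a circle $\Gamma$ with center $O$ and radius $r$ in the Euclidean plane and a point $A$, the power of $A$ with respect to $\Gamma$ is $P_\Gamma(A)=|OA|^2-r^2$. *)

(* Defs.v *)
From HB Require Import structures.
From mathcomp Require Import all_boot all_order all_algebra.
From mathcomp Require Import classical_sets reals.

Set Implicit Arguments.
Unset Strict Implicit.
Unset Printing Implicit Defensive.

Import Order.TTheory GRing.Theory Num.Theory.
Local Open Scope ring_scope.
Local Open Scope classical_set_scope.

(* The Euclidean distance; the norm that MathComp-Analysis puts on row vectors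
   is the sup norm, so it cannot be used here. *)
Definition edist (R : realType) (A B : 'rV[R]_2) : R :=
  Num.sqrt (\sum_(i < 2) (A ord0 i - B ord0 i) ^+ 2).

(* The proof field is a boolean equality, hence proof-irrelevant: two circles
   are equal iff they have the same center and the same radius. *)
Record circle (R : realType) := Circle {
  center : 'rV[R]_2;
  radius : R;
  radius_gt0 : 0 < radius
}.

Definition power (R : realType) (G : circle R) (A : 'rV[R]_2) : R :=
  edist (center G) A ^+ 2 - radius G ^+ 2.

Definition circle_points (R : realType) (G : circle R) : set 'rV[R]_2 :=
  [set X | edist (center G) X = radius G].

Definition is_circle (R : realType) (S : set 'rV[R]_2) : Prop :=
  exists G : circle R, S = circle_points G.

Definition is_line (R : realType) (S : set 'rV[R]_2) : Prop :=
  exists A v : 'rV[R]_2, v != 0 /\ S = [set A + t *: v | t in [set: R]].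

Definition is_point (R : realType) (S : set 'rV[R]_2) : Prop :=
  exists A : 'rV[R]_2, S = [set A].

Definition possibly_degenerate_circle (R : realType) (S : set 'rV[R]_2) : Prop :=
  [\/ is_circle S, is_line S, is_point S | S = set0].

(* Main.v *)
(* Expanding in coordinates turns the condition into
   a (x^2 + y^2) + 2 (b x + c y) + d = 0 with a = 1 - k.  If a <> 0, completing
   the square prescribes the squared distance to a fixed point; if a = 0, the
   equation is affine.  All the coefficients vanish only when k = 1 and the two
   circles coincide. *)
Require Import Defs.
From mathcomp Require Import all_boot all_order all_algebra.
From mathcomp Require Import classical_sets reals.
From mathcomp Require Import ring lra.

Import Order.TTheory GRing.Theory Num.Theory.

Local Open Scope ring_scope.
Local Open Scope classical_set_scope.

Definition point2 {R : realType} (x y : R) : 'rV[R]_2 :=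
  \row_j (if j == ord0 then x else y).

Lemma point2_x {R : realType} (x y : R) : point2 x y ord0 ord0 = x.
Proof. by rewrite mxE. Qed.

Lemma point2_y {R : realType} (x y : R) : point2 x y ord0 ord_max = y.
Proof. by rewrite mxE. Qed.

Lemma eq_point2 {R : realType} (A B : 'rV[R]_2) :
  A ord0 ord0 = B ord0 ord0 -> A ord0 ord_max = B ord0 ord_max -> A = B.
Proof.
move=> eq0 eq1; apply/rowP => -[[|[|//]] lti].
- by rewrite (_ : Ordinal lti = ord0) //; apply: val_inj.
- by rewrite (_ : Ordinal lti = ord_max) //; apply: val_inj.
Qed.

Lemma edist_ge0 {R : realType} (A B : 'rV[R]_2) : 0 <= edist A B.
Proof. exact: sqrtr_ge0. Qed.

Lemma sqr_edist {R : realType} (A B : 'rV[R]_2) :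
  edist A B ^+ 2 = (A ord0 ord0 - B ord0 ord0) ^+ 2
                   + (A ord0 ord_max - B ord0 ord_max) ^+ 2.
Proof.
rewrite /edist sqr_sqrtr; last by apply: sumr_ge0 => i _; apply: sqr_ge0.
rewrite big_ord_recr /= big_ord1.
by rewrite (_ : widen_ord _ _ = ord0) //; apply: val_inj.
Qed.

Lemma edist_eq0 {R : realType} (A B : 'rV[R]_2) : edist A B = 0 -> A = B.
Proof.
move=> AB0; have := sqr_edist A B; rewrite AB0 expr0n /= => /esym/eqP.
rewrite paddr_eq0 ?sqr_ge0// !sqrf_eq0 !subr_eq0 => /andP[/eqP ? /eqP ?].
exact: eq_point2.
Qed.

Lemma edistxx {R : realType} (A : 'rV[R]_2) : edist A A = 0.
Proof. by apply/eqP; rewrite -sqrf_eq0 sqr_edist !subrr expr0n addr0. Qed.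

(** The sign of [rho] decides which shape occurs: a positive value is the square of the radius
    [Num.sqrt rho], and distance zero leaves only [C]. *)
Lemma sqr_edist_locus {R : realType} (C : 'rV[R]_2) (rho : R) :
  possibly_degenerate_circle [set X | edist C X ^+ 2 = rho].
Proof.
case: (ltgtP rho 0) => [rho_lt0 | rho_gt0 | ->].
- apply: Or44; apply/seteqP; split=> X //= eqX.
  by move: rho_lt0; rewrite -eqX ltNge sqr_ge0.
- have sqrt_gt0 : 0 < Num.sqrt rho by rewrite sqrtr_gt0.
  apply: Or41; exists (Circle C sqrt_gt0).
  apply/seteqP; split=> X; rewrite /circle_points /= => eqX.
  + by rewrite -eqX sqrtr_sqr ger0_norm ?edist_ge0.
  + by rewrite eqX sqr_sqrtr // ltW.
- apply: Or43; exists C; apply/seteqP; split=> X /=.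
  + by move/eqP; rewrite sqrf_eq0 => /eqP/edist_eq0 ->.
  + by move=> ->; rewrite edistxx expr0n.
Qed.

Lemma affine_locus {R : realType} (b c d : R) : (b, c) != (0, 0) ->
  is_line [set X : 'rV[R]_2
    | 2 * (b * X ord0 ord0 + c * X ord0 ord_max) + d = 0].
Proof.
move=> bc0; set n := b ^+ 2 + c ^+ 2.
have n0 : n != 0.
  by rewrite paddr_eq0 ?sqr_ge0// !sqrf_eq0; move: bc0; rewrite xpair_eqE.
(* The base point is the foot of the perpendicular from the origin; the direction [(- c, b)] is
   orthogonal to the normal [(b, c)]. *)
exists (point2 (- d * b / (2 * n)) (- d * c / (2 * n))).
exists (point2 (- c) b); split.
  apply: contraNneq bc0 => v0; apply/eqP; congr (_, _).
  - by rewrite -(point2_y (- c) b) v0 mxE.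
  - by apply: oppr_inj; rewrite oppr0 -(point2_x (- c) b) v0 mxE.
apply/seteqP; split=> [X /= eqX | X /= [t _ <-]].
- have {}eqX : d = - (2 * (b * X ord0 ord0 + c * X ord0 ord_max)) by lra.
  (* As the foot is orthogonal to [(- c, b)], the parameter is the inner product of [X] with that
     direction, divided by its squared length [n]. *)
  exists ((b * X ord0 ord_max - c * X ord0 ord0) / n) => //.
  by apply: eq_point2; rewrite !mxE /= eqX /n; field.
- by rewrite !mxE /= /n; field.
Qed.

(** The zero equation is excluded because its locus is the whole plane, which is none of the listed
    shapes. *)
Lemma circle_equation_locus {R : realType} (a b c d : R) :
  ~ [/\ a = 0, b = 0, c = 0 & d = 0] ->
  possibly_degenerate_circle [set X : 'rV[R]_2
    | a * (X ord0 ord0 ^+ 2 + X ord0 ord_max ^+ 2)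
      + 2 * (b * X ord0 ord0 + c * X ord0 ord_max) + d = 0].
Proof.
have [-> | a0 _] := eqVneq a 0; last first.
  (* Division by [a] and completing both squares give this center and this right-hand side, which
     may have any sign. *)
  rewrite (_ : mkset _ = [set X | edist (point2 (- b / a) (- c / a)) X ^+ 2
                           = (b ^+ 2 + c ^+ 2) / a ^+ 2 - d / a]).
    exact: sqr_edist_locus.
  apply/seteqP; split=> X /=; rewrite sqr_edist point2_x point2_y.
  - set x := X ord0 ord0; set y := X ord0 ord_max => eqX.
    have -> : d = - (a * (x ^+ 2 + y ^+ 2) + 2 * (b * x + c * y)) by lra.
    by field.
  - set x := X ord0 ord0; set y := X ord0 ord_max.
    (* Multiplied by [a], the difference of the two sides is the original polynomial. *)
    move/(congr1 (fun z => a * (z - ((b ^+ 2 + c ^+ 2) / a ^+ 2 - d / a)))).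
    by rewrite subrr mulr0 => <-; field.
have [[-> ->] nz | bc0 _] := eqVneq (b, c) (0, 0).
  apply: Or44; apply/seteqP; split=> X //=.
  by rewrite !mul0r !addr0 mulr0 !add0r => d0; apply: nz.
apply: Or42; under [mkset _]eq_set do rewrite mul0r add0r.
exact: affine_locus.
Qed.

Lemma eq_circle {R : realType} (G1 G2 : circle R) :
  center G1 = center G2 -> radius G1 = radius G2 -> G1 = G2.
Proof.
case: G1 G2 => [C1 r1 h1] [C2 r2 h2] /= eqC eqr.
by subst C2 r2; rewrite (bool_irrelevance h1 h2).
Qed.

(* For coinciding circles and k = 1 the locus is the whole plane; only this
   case is excluded. *)
Theorem theorem2p1 (R : realType) (Gamma1 Gamma2 : circle R) (k : R)
    (nontrivial : ~ (Gamma1 = Gamma2 /\ k = 1)) :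
  possibly_degenerate_circle
    [set X : 'rV[R]_2 | power Gamma1 X = k * power Gamma2 X].
Proof.
set x1 := center Gamma1 ord0 ord0; set y1 := center Gamma1 ord0 ord_max.
set x2 := center Gamma2 ord0 ord0; set y2 := center Gamma2 ord0 ord_max.
set r1 := radius Gamma1; set r2 := radius Gamma2.
(* This is the constant term of [power Gamma1 X - k * power Gamma2 X] as a polynomial in the
   coordinates of [X]. *)
pose d := x1 ^+ 2 + y1 ^+ 2 - r1 ^+ 2 - k * (x2 ^+ 2 + y2 ^+ 2 - r2 ^+ 2).
rewrite (_ : mkset _ = [set X : 'rV[R]_2
    | (1 - k) * (X ord0 ord0 ^+ 2 + X ord0 ord_max ^+ 2)
      + 2 * ((k * x2 - x1) * X ord0 ord0 + (k * y2 - y1) * X ord0 ord_max)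
      + d = 0]).
  (* If every coefficient vanishes, then [k = 1], so the linear terms force equal centers and
     [d = 0] forces equal squared radii. *)
  apply: circle_equation_locus => -[k1 eqx eqy d0]; apply: nontrivial.
  have {}k1 : k = 1 by lra.
  move: eqx eqy d0; rewrite /d k1 !mul1r => /eqP + /eqP + d0.
  rewrite !subr_eq0 => /eqP eqx /eqP eqy; split=> //; apply: eq_circle.
  - exact: eq_point2.
  - have r12 : r1 ^+ 2 = r2 ^+ 2 by move: d0; rewrite eqx eqy; lra.
    (* Squaring is injective on positive radii. *)
    by apply/eqP; rewrite -(@eqrXn2 _ 2) ?ltW ?radius_gt0// -/r1 r12.
apply/seteqP; split=> X /=; rewrite /power !sqr_edist /d -/x1 -/y1 -/x2 -/y2;
  rewrite -/r1 -/r2; set x := X ord0 ord0; set y := X ord0 ord_max => eqX.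
- by apply/eqP; move/eqP: eqX; rewrite -subr_eq0 => /eqP <-; apply/eqP; ring.
- by apply/eqP; rewrite -subr_eq0 -eqX; apply/eqP; ring.
Qed.
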